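(* The algebra $\mathcal{A}_0$ is of wild representation type.
   Context: $\Bbbk$ is an algebraically closed field of characteristic zero. $\mathcal{A}_0$ is the 72-dimensional $\Bbbk$-algebra generated by $H_t$ ($t\in\mathbb{S}_3$) and $a_{12},a_{13},a_{23}$ (indexed by the transpositions of $\mathbb{S}_3$), with relations $H_e=1$, $H_tH_s=H_{ts}$; $H_ta_i=\operatorname{sgn}(t)a_{tit^{-1}}H_t$; $a_{12}^2=0$; $a_{12}a_{23}+a_{23}a_{13}+a_{13}a_{12}=0$. *)

(* Defs.v *)
From HB Require Import structures.
From mathcomp Require Import all_boot all_order all_algebra all_fingroup.
From mathcomp Require Import generic_quotient ring_quotient.
From mathcomp Require Import boolp finmap.
From mathcomp.multinomials Require Import monalg.

Set Implicit Arguments.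
Unset Strict Implicit.
Unset Printing Implicit Defensive.

Import GRing.Theory.
Local Open Scope ring_scope.
Local Open Scope quotient_scope.

(* The free associative algebra k<X>, as the algebra of the free monoid on X. *)
Section FreeAlgebra.
Variables (k : comNzRingType) (X : choiceType).

Definition freeAlg : Type := {malg k[{fmonom X}]}.

HB.instance Definition _ := GRing.Lalgebra.on freeAlg.

Lemma freeAlg_scalerAr (c : k) (x y : freeAlg) : c *: (x * y) = x * (c *: y).
Proof.
apply/malgP => m; rewrite mcoeffZ.
rewrite (@mcoeffMlw _ _ (msupp x) (msupp y) x y) //.
rewrite (@mcoeffMlw _ _ (msupp x) (msupp y) x (c *: y)) //; last exact: msuppZ_le.
rewrite mulr_sumr; apply: eq_bigr => m1 _; rewrite mulr_sumr.
by apply: eq_bigr => m2 _; rewrite mcoeffZ mulrnAr mulrCA.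
Qed.

HB.instance Definition _ :=
  GRing.Lalgebra_isAlgebra.Build k freeAlg freeAlg_scalerAr.

Definition gen (x : X) : freeAlg := << fmu x >>.

End FreeAlgebra.

Inductive ideal_gen (k : comNzRingType) (A : algType k) (S : A -> Prop) :
    A -> Prop :=
| ideal_gen0 : ideal_gen S 0
| ideal_genD u r v x : S r -> ideal_gen S x -> ideal_gen S (u * r * v + x).

(* The library equips only quotients of commutative rings with a product; it
   does provide the additive quotient, to which we add the algebra structure.
   The hypothesis that the ideal is proper is needed because the algebras of
   the library are non-zero. *)
Section QuotientAlgebra.
Variables (k : comNzRingType) (A : algType k) (S : A -> Prop).

Lemma ideal_gen_add x y : ideal_gen S x -> ideal_gen S y -> ideal_gen S (x + y).
Proof.
by elim=> [|u r v z Sr _ IH] ?; rewrite ?add0r // -addrA; constructor; auto.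
Qed.

Lemma ideal_gen_mull a x : ideal_gen S x -> ideal_gen S (a * x).
Proof.
elim=> [|u r v z Sr _ IH]; first by rewrite mulr0; constructor.
by rewrite mulrDr !mulrA; constructor.
Qed.

Lemma ideal_gen_mulr a x : ideal_gen S x -> ideal_gen S (x * a).
Proof.
elim=> [|u r v z Sr _ IH]; first by rewrite mul0r; constructor.
by rewrite mulrDl -[u * r * v * a]mulrA; constructor.
Qed.

Definition ideal_pred : A -> bool := fun x => `[< ideal_gen S x >].

Lemma ideal_pred_zmod : zmod_closed ideal_pred.
Proof.
split=> [|x y]; first by apply/asboolP; constructor.
move=> /asboolP Ix /asboolP Iy; apply/asboolP; apply: ideal_gen_add => //.
by rewrite -mulN1r; apply: ideal_gen_mull.
Qed.

HB.instance Definition _ := GRing.isZmodClosed.Build A ideal_pred ideal_pred_zmod.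

Definition two_sided_ideal : zmodClosed A :=
  GRing.ZmodClosed.clone A ideal_pred _.

Local Notation zQ := {ideal_quot two_sided_ideal}.

Definition quotAlg (proper : ~ ideal_gen S 1) : Type := zQ.

Variable proper : ~ ideal_gen S 1.
Local Notation Q := (quotAlg proper).

HB.instance Definition _ := GRing.Zmodule.on Q.

Definition to_quot (x : A) : Q := \pi_zQ x.

Definition qrepr (q : Q) : A := repr (q : zQ).

Lemma qreprK q : to_quot (qrepr q) = q.
Proof. exact: reprK. Qed.

Lemma to_quot_eq x y : to_quot x = to_quot y <-> ideal_gen S (x - y).
Proof.
rewrite /to_quot; split.
  by move/eqP; rewrite -Quotient.idealrBE => /asboolP.
by move=> Ixy; apply/eqP; rewrite -Quotient.idealrBE; apply/asboolP.
Qed.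

Lemma to_quotB : {morph to_quot : x y / x - y}.
Proof. by move=> x y; rewrite /to_quot !piE. Qed.

Lemma to_quotD : {morph to_quot : x y / x + y}.
Proof. by move=> x y; rewrite /to_quot !piE. Qed.

Definition qone : Q := to_quot 1.
Definition qmul (p q : Q) : Q := to_quot (qrepr p * qrepr q).
Definition qscale (c : k) (q : Q) : Q := to_quot (c *: qrepr q).

Lemma qreprE x : ideal_gen S (qrepr (to_quot x) - x).
Proof. by apply/to_quot_eq; rewrite qreprK. Qed.

Lemma to_quotM x y : to_quot (x * y) = qmul (to_quot x) (to_quot y).
Proof.
symmetry; apply/to_quot_eq.
have -> : qrepr (to_quot x) * qrepr (to_quot y) - x * y =
    (qrepr (to_quot x) - x) * qrepr (to_quot y)
    + x * (qrepr (to_quot y) - y).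
  by rewrite mulrBl mulrBr addrA subrK.
by apply: ideal_gen_add; [apply: ideal_gen_mulr | apply: ideal_gen_mull];
   apply: qreprE.
Qed.

Lemma to_quotZ c x : to_quot (c *: x) = qscale c (to_quot x).
Proof.
symmetry; apply/to_quot_eq; rewrite -scalerBr -mulr_algl.
exact/ideal_gen_mull/qreprE.
Qed.

Lemma qmulA : associative qmul.
Proof.
by move=> x y z; rewrite -[x]qreprK -[y]qreprK -[z]qreprK -!to_quotM mulrA.
Qed.

Lemma qmul1 : left_id qone qmul.
Proof. by move=> x; rewrite -[x]qreprK -to_quotM mul1r. Qed.

Lemma qmulr1 : right_id qone qmul.
Proof. by move=> x; rewrite -[x]qreprK -to_quotM mulr1. Qed.

Lemma qmulDl : left_distributive qmul +%R.
Proof.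
move=> x y z; rewrite -[x]qreprK -[y]qreprK -[z]qreprK.
by rewrite -to_quotD -!to_quotM -to_quotD mulrDl.
Qed.

Lemma qmulDr : right_distributive qmul +%R.
Proof.
move=> x y z; rewrite -[x]qreprK -[y]qreprK -[z]qreprK.
by rewrite -to_quotD -!to_quotM -to_quotD mulrDr.
Qed.

Lemma qone_neq0 : qone != 0.
Proof.
apply/eqP => q1; apply: proper; rewrite -[1]subr0; apply/to_quot_eq.
by rewrite -[to_quot 1]/qone q1 -[0 in RHS](subrr 0) to_quotB subrr.
Qed.

HB.instance Definition _ := GRing.Zmodule_isNzRing.Build Q
  qmulA qmul1 qmulr1 qmulDl qmulDr qone_neq0.

Lemma qscaleA c d q : qscale c (qscale d q) = qscale (c * d) q.
Proof. by rewrite -[q]qreprK -!to_quotZ scalerA. Qed.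

Lemma qscale1 : left_id 1 qscale.
Proof. by move=> q; rewrite -[q]qreprK -to_quotZ scale1r. Qed.

Lemma qscaleDr : right_distributive qscale +%R.
Proof.
move=> c x y; rewrite -[x]qreprK -[y]qreprK.
by rewrite -to_quotD -!to_quotZ -to_quotD scalerDr.
Qed.

Lemma qscaleDl q : {morph qscale^~ q : c d / c + d}.
Proof.
by move=> c d; rewrite -[q]qreprK -!to_quotZ -to_quotD scalerDl.
Qed.

HB.instance Definition _ := GRing.Zmodule_isLmodule.Build k Q
  qscaleA qscale1 qscaleDr qscaleDl.

Lemma qscaleAl c (x y : Q) : c *: (x * y) = (c *: x) * y.
Proof.
rewrite -[x]qreprK -[y]qreprK.
change (qscale c (qmul (to_quot (qrepr x)) (to_quot (qrepr y))) = qmul (qscale c (to_quot (qrepr x))) (to_quot (qrepr y))).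
by rewrite -to_quotM -to_quotZ scalerAl to_quotM to_quotZ.
Qed.

HB.instance Definition _ := GRing.Lmodule_isLalgebra.Build k Q qscaleAl.

Lemma qscaleAr c (x y : Q) : c *: (x * y) = x * (c *: y).
Proof.
rewrite -[x]qreprK -[y]qreprK.
change (qscale c (qmul (to_quot (qrepr x)) (to_quot (qrepr y))) = qmul (to_quot (qrepr x)) (qscale c (to_quot (qrepr y)))).
by rewrite -to_quotM -to_quotZ scalerAr to_quotM to_quotZ.
Qed.

HB.instance Definition _ := GRing.Lalgebra_isAlgebra.Build k Q qscaleAr.

End QuotientAlgebra.

(* Modules over a k-algebra A are its left modules [lmodType A]; the scalar
   c : k acts on them as c%:A. *)
Section Modules.
Variables (k : fieldType) (A : algType k).

Definition fin_dim (V : lmodType A) : Prop :=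
  exists (n : nat) (e : 'I_n -> V),
    forall v : V, exists c : 'I_n -> k, v = \sum_(i < n) (c i)%:A *: e i.

Definition mod_iso (V W : lmodType A) : Prop :=
  exists f : {linear V -> W}, bijective f.

Definition zero_mod (V : lmodType A) : Prop := forall v : V, v = 0.

Definition indecomposable (V : lmodType A) : Prop :=
  ~ zero_mod V /\
  forall U W : lmodType A, mod_iso V (U * W)%type -> zero_mod U \/ zero_mod W.

End Modules.

(* A-B-bimodules (with k acting centrally) that are free of finite rank as
   right B-modules.  The right B-module is the module B^n of columns; its
   endomorphisms are the left multiplications by n x n matrices over B, so
   that the left A-action is a morphism of k-algebras A -> M_n(B). *)
Record free_bimod (k : fieldType) (A B : algType k) := FreeBimod {
  bimod_rank : nat;
  bimod_act :> {rmorphism A -> 'M[B]_bimod_rank};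
  bimod_actZ : forall c : k, bimod_act c%:A = (c%:A)%:M
}.

(* M (x)_B V = B^n (x)_B V is V^n, on which A acts through matrices over B;
   see tensor_universal below. *)
Section Tensor.
Variables (k : fieldType) (A B : algType k).

Definition tensor (M : free_bimod A B) (V : lmodType B) : Type :=
  {ffun 'I_(bimod_rank M) -> V}.

Variables (M : free_bimod A B) (V : lmodType B).
Local Notation n := (bimod_rank M).
Local Notation T := (tensor M V).

HB.instance Definition _ := GRing.Zmodule.on T.

Definition tensor_scale (a : A) (v : T) : T :=
  [ffun i => \sum_(j < n) M a i j *: (v : {ffun 'I_n -> V}) j].

Lemma tensor_scaleA a b v :
  tensor_scale a (tensor_scale b v) = tensor_scale (a * b) v.
Proof.
apply/ffunP => i; rewrite !ffunE rmorphM /=.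
under eq_bigr do rewrite ffunE scaler_sumr.
rewrite exchange_big /=; apply: eq_bigr => j _.
by rewrite mxE scaler_suml; apply: eq_bigr => l _; rewrite scalerA.
Qed.

Lemma tensor_scale1 : left_id 1 tensor_scale.
Proof.
move=> v; apply/ffunP => i; rewrite ffunE rmorph1 (bigD1 i) //= mxE eqxx scale1r.
by rewrite big1 ?addr0 // => j ji; rewrite mxE eq_sym (negbTE ji) scale0r.
Qed.

Lemma tensor_scaleDr : right_distributive tensor_scale +%R.
Proof.
move=> a v w; apply/ffunP => i; rewrite !ffunE -big_split /=.
by apply: eq_bigr => j _; rewrite ffunE scalerDr.
Qed.

Lemma tensor_scaleDl v : {morph tensor_scale^~ v : a b / a + b}.
Proof.
move=> a b; apply/ffunP => i; rewrite !ffunE -big_split /= rmorphD.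
by apply: eq_bigr => j _; rewrite mxE scalerDl.
Qed.

HB.instance Definition _ := GRing.Zmodule_isLmodule.Build A T
  tensor_scaleA tensor_scale1 tensor_scaleDr tensor_scaleDl.

Definition pure_tensor (m : 'cV[B]_n) (v : V) : T :=
  [ffun i => m i ord0 *: v].

Lemma pure_tensor_act a m v : pure_tensor (M a *m m) v = a *: pure_tensor m v.
Proof.
apply/ffunP => i; rewrite !ffunE mxE scaler_suml.
by apply: eq_bigr => j _; rewrite ffunE scalerA.
Qed.

Definition balanced (W : zmodType) (f : 'cV[B]_n -> V -> W) : Prop :=
  [/\ forall m m' v, f (m + m') v = f m v + f m' v,
      forall m v v', f m (v + v') = f m v + f m v' &
      forall m b v, f (m *m b%:M) v = f m (b *: v)].

Lemma pure_tensor_balanced : balanced pure_tensor.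
Proof.
split=> [m m' v|m v v'|m b v]; apply/ffunP => i; rewrite !ffunE.
- by rewrite mxE scalerDl.
- by rewrite scalerDr.
by rewrite mxE big_ord1 mxE eqxx scalerA.
Qed.

Lemma tensor_universal (W : zmodType) (f : 'cV[B]_n -> V -> W) :
  balanced f ->
  exists! g : T -> W, {morph g : x y / x + y} /\
                      forall m v, g (pure_tensor m v) = f m v.
Proof.
case=> fDl fDr fB.
have f0 m : f m 0 = 0 by apply: (addrI (f m 0)); rewrite -fDr !addr0.
have fsum m (r : seq 'I_n) (F : 'I_n -> V) :
    f m (\sum_(i <- r) F i) = \sum_(i <- r) f m (F i).
  by elim: r => [|i r IH]; rewrite ?big_nil ?f0 // !big_cons fDr IH.
have f0l v : f 0 v = 0 by apply: (addrI (f 0 v)); rewrite -fDl !addr0.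
have fsuml v (r : seq 'I_n) (F : 'I_n -> 'cV[B]_n) :
    f (\sum_(i <- r) F i) v = \sum_(i <- r) f (F i) v.
  by elim: r => [|i r IH]; rewrite ?big_nil ?f0l // !big_cons fDl IH.
pose e (i : 'I_n) : 'cV[B]_n := delta_mx i ord0.
have col_sum (m : 'cV[B]_n) : m = \sum_i e i *m (m i ord0)%:M.
  apply/matrixP => i j; rewrite summxE ord1 (bigD1 i) //= big1 => [|l li].
    by rewrite addr0 mxE big_ord1 !mxE !eqxx mul1r.
  by rewrite mxE big_ord1 !mxE eq_sym (negbTE li) mul0r.
have T_sum (t : T) :
    t = \sum_i pure_tensor (e i) ((t : {ffun 'I_n -> V}) i).
  apply/ffunP => i; rewrite sum_ffunE (bigD1 i) //= big1 => [|l li].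
    by rewrite addr0 ffunE mxE !eqxx scale1r.
  by rewrite ffunE mxE eq_sym (negbTE li) scale0r.
exists (fun t => \sum_i f (e i) ((t : {ffun 'I_n -> V}) i)); split.
  split=> [x y|m v].
    by rewrite -big_split /=; apply: eq_bigr => i _; rewrite ffunE fDr.
  rewrite [m in RHS]col_sum fsuml; apply: eq_bigr => i _.
  by rewrite ffunE fB.
move=> g [gD gf]; apply: functional_extensionality_dep => t.
have g0 : g 0 = 0 by apply: (addrI (g 0)); rewrite -gD !addr0.
by rewrite [t in RHS]T_sum (big_morph g gD g0); apply: eq_bigr => i _; rewrite gf.
Qed.

End Tensor.

(* Drozd's definition; k<x,y> is the free algebra on the two letters of bool. *)
Definition wild (k : fieldType) (A : algType k) : Prop :=
  exists M : free_bimod A (freeAlg k bool),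
    (forall V : lmodType (freeAlg k bool), fin_dim V ->
       indecomposable V -> indecomposable (tensor M V)) /\
    (forall V W : lmodType (freeAlg k bool), fin_dim V -> fin_dim W ->
       mod_iso (tensor M V) (tensor M W) -> mod_iso V W).

Definition is_transp (s : 'S_3) : bool :=
  [exists x, exists y, (x != y) && (s == tperm x y)].

Definition transp : Type := {s : 'S_3 | is_transp s}.

HB.instance Definition _ := Finite.on transp.

Lemma is_transp_tperm (x y : 'I_3) : x != y -> is_transp (tperm x y).
Proof.
by move=> xy; apply/existsP; exists x; apply/existsP; exists y; rewrite xy /=.
Qed.

Lemma is_transp_conj (t : 'S_3) (i : transp) :
  is_transp (t * val i * t^-1)%g.
Proof.
case: i => s /= /existsP[x /existsP[y /andP[xy /eqP->]]].
have -> : (t * tperm x y * t^-1 = tperm (t^-1 x) (t^-1 y))%g.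
  by rewrite -tpermJ conjgE invgK mulgA.
by apply: is_transp_tperm; rewrite (inj_eq perm_inj).
Qed.

Definition mk_transp (x y : 'I_3) (xy : x != y) : transp :=
  exist _ (tperm x y) (is_transp_tperm xy).

Definition transp_conj (t : 'S_3) (i : transp) : transp :=
  exist _ (t * val i * t^-1)%g (is_transp_conj t i).

(* The letters 1, 2, 3 are the elements 0, 1, 2 of 'I_3. *)
Definition o1 : 'I_3 := @Ordinal 3 0 isT.
Definition o2 : 'I_3 := @Ordinal 3 1 isT.
Definition o3 : 'I_3 := @Ordinal 3 2 isT.
Definition t12 : transp := @mk_transp o1 o2 isT.
Definition t13 : transp := @mk_transp o1 o3 isT.
Definition t23 : transp := @mk_transp o2 o3 isT.

(* The library composes permutations from left to right.  This does not affect
   the algebra: inversion is an isomorphism from S_3 to its opposite group that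
   fixes the transpositions and preserves signs. *)
Section A0.
Variable k : fieldType.

Definition A0_gens : choiceType := ('S_3 + transp)%type.
Definition genH (t : 'S_3) : freeAlg k A0_gens := gen k (inl t).
Definition gena (i : transp) : freeAlg k A0_gens := gen k (inr i).

Inductive A0_rel : freeAlg k A0_gens -> Prop :=
| A0_H1 : A0_rel (genH 1%g - 1)
| A0_HM t s : A0_rel (genH t * genH s - genH (t * s)%g)
| A0_Ha t i : A0_rel (genH t * gena i - (-1) ^+ t *: (gena (transp_conj t i) * genH t))
| A0_aa : A0_rel (gena t12 ^+ 2)
| A0_aaa : A0_rel (gena t12 * gena t23 + gena t23 * gena t13 + gena t13 * gena t12).

Definition A0_trivial_monom (m : {fmonom A0_gens}) : k :=
  (all (fun g : A0_gens => if g is inl _ then true else false) m)%:R.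

Lemma A0_trivial_monomM : mmorphism A0_trivial_monom.
Proof.
split=> [m1 m2|]; last by rewrite /A0_trivial_monom fm1.
by rewrite /A0_trivial_monom fmM all_cat -natrM mulnb.
Qed.

HB.instance Definition _ :=
  monalg.isMultiplicative.Build _ k A0_trivial_monom A0_trivial_monomM.

Definition A0_trivial (x : freeAlg k A0_gens) : k :=
  mmap idfun A0_trivial_monom x.

HB.instance Definition _ := GRing.RMorphism.copy A0_trivial
  (mmap idfun A0_trivial_monom : {malg k[{fmonom A0_gens}]} -> k).

Lemma A0_trivialH t : A0_trivial (genH t) = 1.
Proof. by rewrite /A0_trivial mmapU mul1r /A0_trivial_monom fmuE. Qed.

Lemma A0_triviala i : A0_trivial (gena i) = 0.
Proof. by rewrite /A0_trivial mmapU mul1r /A0_trivial_monom fmuE. Qed.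

Lemma A0_trivialZ c x : A0_trivial (c *: x) = c * A0_trivial x.
Proof. exact: mmapZ. Qed.

(* H_t |-> 1, a_i |-> 0 is a one-dimensional representation. *)
Lemma A0_proper : ~ ideal_gen A0_rel 1.
Proof.
move=> I1; suff: A0_trivial 1 = 0 by move/eqP; rewrite rmorph1 oner_eq0.
elim: I1 => [|u r v x Sr _ IH]; first exact: rmorph0.
rewrite rmorphD !rmorphM /= IH addr0; suff -> : A0_trivial r = 0.
  by rewrite mulr0 mul0r.
case: Sr => [|t s|t i||]; rewrite ?rmorphD ?rmorphN ?rmorphM ?rmorphXn /=.
- by rewrite rmorph1 A0_trivialH subrr.
- by rewrite !A0_trivialH mul1r subrr.
- by rewrite A0_trivialZ rmorphM /= !A0_triviala mulr0 mul0r mulr0 subrr.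
- by rewrite !A0_triviala mulr0.
by rewrite !A0_triviala !mul0r !addr0.
Qed.

Definition A0 : algType k := quotAlg A0_proper.

End A0.

(* Main.v *)
(* Write B = k<x,y>, let P be the permutation representation of S_3 on three
   letters and sgn its sign.  For a B-module V, the group S_3 acts on
   (P (x) V) + (sgn P (x) V), and any S_3-equivariant family of maps a_i from
   the first ("top") summand to the second ("bottom") one makes it an
   A_0-module, since all products of two a_i vanish.  Such a family has one
   free parameter in B for each of the five orbits of S_3 on triples of letters.
   The parameters below are chosen so that an A_0-linear map between two such
   modules is, up to a map from top to bottom, h (x) 1 for a B-linear h.  Hence
   f |-> h is functorial and its kernel consists of square-zero endomorphisms,
   so the functor reflects isomorphisms and, by lifting idempotents, preserves
   indecomposability. *)

From HB Require Import structures.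
Require Import Defs.
From mathcomp Require Import all_boot all_order all_algebra all_fingroup.
From mathcomp.multinomials Require Import monalg.

Set Implicit Arguments.
Unset Strict Implicit.
Unset Printing Implicit Defensive.

Import GRing.Theory.
Local Open Scope ring_scope.

(** * Maps out of free algebras and quotient algebras *)

(** A word goes to the product of the images of its letters; as [R] need not be commutative,
    multiplicativity rests on scalars commuting with these images. *)
Lemma free_lift (k : comNzRingType) (X : choiceType) (R : nzRingType)
    (f : {rmorphism k -> R}) (G : X -> R) :
    (forall c x, GRing.comm (f c) (G x)) ->
  exists F : {rmorphism freeAlg k X -> R},
    (forall x, F (gen k x) = G x) /\ forall c, F c%:A = f c.
Proof.
move=> fG; pose h (m : {fmonom X}) := \prod_(x <- m) G x.
have hM : mmorphism h by split=> [m m'|]; rewrite /h ?fmM ?big_cat ?fm1 ?big_nil.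
pose hL : {mmorphism {fmonom X} -> R} := HB.pack h
  (monalg.isMultiplicative.Build _ R h hM).
have comm_fh c m : GRing.comm (f c) (hL m) by apply: commr_prod => x _; apply: fG.
have FM : multiplicative (mmap f hL : freeAlg k X -> R).
  by apply: commr_mmap_is_multiplicative => g m m'; apply: comm_fh.
pose F : {rmorphism freeAlg k X -> R} := HB.pack (mmap f hL : freeAlg k X -> R)
  (GRing.isAdditive.Build (freeAlg k X) R (mmap f hL) (@mmap_is_additive _ _ _ _ _))
  (GRing.isMultiplicative.Build (freeAlg k X) R (mmap f hL) FM).
exists F; split=> [x|c] /=.
  rewrite mmapU -[RHS]mul1r; congr (_ * _); first exact: (rmorph1 f).
  by rewrite /= /h fmuE big_seq1.
rewrite -[RHS]mulr1 -[X in _ = _ * X](mmap1 (f := f) (h := hL)).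
exact: (@mmapZ _ _ _ f hL c 1).
Qed.

Lemma quot_lift (k : comNzRingType) (A : algType k) (S : A -> Prop)
    (proper : ~ ideal_gen S 1) (R : nzRingType) (F : {rmorphism A -> R}) :
    (forall r, S r -> F r = 0) ->
  exists F' : {rmorphism quotAlg proper -> R}, forall x, F' (to_quot proper x) = F x.
Proof.
move=> FS.
have FI x : ideal_gen S x -> F x = 0.
  elim=> [|u r v z Sr _ IH]; first exact: rmorph0.
  by rewrite rmorphD !rmorphM /= (FS r Sr) IH mulr0 mul0r addr0.
pose F' (q : quotAlg proper) := F (qrepr q).
have F'E x : F' (to_quot proper x) = F x.
  by apply/eqP; rewrite -subr_eq0 -rmorphB; apply/eqP/FI/qreprE.
have F'B : additive F'.
  by move=> p q; rewrite -[p]qreprK -[q]qreprK -to_quotB !F'E rmorphB.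
have F'M : multiplicative F'.
  split=> [p q|].
    rewrite -[p]qreprK -[q]qreprK -[_ * _]/(qmul _ _) -to_quotM !F'E.
    exact: rmorphM.
  by rewrite -[1]/(to_quot proper 1) F'E rmorph1.
pose L : {rmorphism quotAlg proper -> R} := HB.pack F'
  (GRing.isAdditive.Build (quotAlg proper) R F' F'B)
  (GRing.isMultiplicative.Build (quotAlg proper) R F' F'M).
by exists L.
Qed.

(** Every element is a combination of words, so induction on the length of a word reduces linearity
    to scalars and letters. *)
Lemma free_linear (k : comNzRingType) (X : choiceType)
    (V W : lmodType (freeAlg k X)) (p : {additive V -> W}) :
    (forall c v, p (c%:A *: v) = c%:A *: p v) ->
    (forall x v, p (gen k x *: v) = gen k x *: p v) ->
  linear p.
Proof.
move=> pc px b u v; rewrite raddfD; congr (_ + _).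
have pm (m : {fmonom X}) w :
    p ((<< m >> : freeAlg k X) *: w) = (<< m >> : freeAlg k X) *: p w.
  case: m => s; elim: s w => [|a s IH] w.
    by rewrite -fmoneE !scale1r.
  have -> : (<< FMonom (a :: s) >> : freeAlg k X) = gen k a * << FMonom s >>.
    by rewrite [RHS]malgM_def fgmulUU mul1r fmuE [in RHS]/mmul /= fmmulE.
  by rewrite -!scalerA px IH.
rewrite [b]monalgE !scaler_suml raddf_sum; apply: eq_bigr => m _.
have -> : (<< b@_m *g m >> : freeAlg k X) = (b@_m)%:A * << m >>.
  by apply/malgP => m'; rewrite mulr_algl mcoeffZ !mcoeffU mulrnAr mulr1.
by rewrite -!scalerA pc pm.
Qed.

(** * Kernels and the splitting of idempotents *)

Section LinearKernel.
Variables (R : pzRingType) (V W : lmodType R) (f : {linear V -> W}).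

Definition linker_pred : pred V := fun v => f v == 0.

Lemma linker_closed : submod_closed linker_pred.
Proof.
split=> [|a u v]; rewrite /linker_pred !unfold_in /= ?linear0 //.
by move=> /eqP fu /eqP fv; rewrite linearP fu fv scaler0 addr0.
Qed.

HB.instance Definition _ := GRing.isSubmodClosed.Build R V linker_pred linker_closed.

(** A module type of its own, because [indecomposable] quantifies over modules and not over
    submodules. *)
Definition linker : Type := {v : V | linker_pred v}.

HB.instance Definition _ := SubType.on linker.
HB.instance Definition _ := Choice.on linker.
HB.instance Definition _ := [SubChoice_isSubLmodule of linker by <:].

End LinearKernel.

(** Writing v = h v + (v - h v) splits [V] into ker (1 - h) and ker h. The last two clauses turn the
    vanishing of a summand into h = 0 or h = 1. *)
Lemma idempotent_split (R : pzRingType) (V : lmodType R) (h : {linear V -> V}) :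
    (forall v, h (h v) = h v) ->
  exists U W : lmodType R, [/\ exists f : {linear V -> (U * W)%type}, bijective f,
    (forall u : U, u = 0) -> forall v, h v = 0 &
    (forall w : W, w = 0) -> forall v, h v = v].
Proof.
move=> hh; pose h' : {linear V -> V} := idfun \- h.
have h'h v : linker_pred h' (h v) by rewrite /linker_pred /h' /= hh subrr.
have hh' v : linker_pred h (v - h v) by rewrite /linker_pred linearB /= hh subrr.
pose f v : (linker h' * linker h)%type :=
  (exist (linker_pred h') _ (h'h v), exist (linker_pred h) _ (hh' v)).
have f_lin : linear f.
  move=> a u v; congr pair; apply: val_inj; rewrite /= linearP //=.
  by rewrite scalerBr opprD addrACA.
pose fL : {linear V -> (linker h' * linker h)%type} := HB.pack f
  (GRing.isLinear.Build R V (linker h' * linker h)%type _ f f_lin).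
exists (linker h'), (linker h); split.
- exists fL; exists (fun uw => val uw.1 + val uw.2) => [v|[[u hu] [w hw]]].
    by rewrite /= addrC subrK.
  have {}hu' : h u = u by move/eqP: (hu); rewrite /h' /= => /subr0_eq.
  have {}hw' : h w = 0 by apply/eqP.
  congr pair; apply: val_inj; rewrite /= linearD hu' hw' /= ?addr0 //.
  by rewrite addrC addKr.
- by move=> U0 v; have /(congr1 val) := U0 (exist (linker_pred h') _ (h'h v)).
move=> W0 v; have /(congr1 val)/= := W0 (exist (linker_pred h) _ (hh' v)).
by move=> /subr0_eq <-.
Qed.

(** * Matrix components of maps between tensor modules *)

Section Coordinates.
Variables (k : fieldType) (A B : algType k) (M : free_bimod A B).
Variable o : 'I_(bimod_rank M).
Implicit Types V W : lmodType B.

Definition tcoord V (w : tensor M V) : V := (w : {ffun 'I_(bimod_rank M) -> V}) o.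

Definition tinj V (v : V) : tensor M V := [ffun i => if i == o then v else 0].

Lemma tinjK V (v : V) : tcoord (tinj v) = v.
Proof. by rewrite /tcoord ffunE eqxx. Qed.

End Coordinates.

Arguments tinj [k A B] M o [V] v.

(** Entry (i, j) of F N = N F for a matrix [F] of maps. The components are only additive, since
    A-linear maps are not assumed B-linear; hence [N c j] stays inside [F i c]. *)
Definition intertwines (B : nzRingType) (n : nat) (V W : lmodType B)
    (F : 'I_n -> 'I_n -> {additive V -> W}) (N : 'M[B]_n) : Prop :=
  forall i j v, \sum_c F i c (N c j *: v) = \sum_c N i c *: F c j v.

Lemma tensor_comps (k : fieldType) (A B : algType k) (M : free_bimod A B)
    (V W : lmodType B) (f : {linear tensor M V -> tensor M W}) :
  exists F : 'I_(bimod_rank M) -> 'I_(bimod_rank M) -> {additive V -> W},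
    (forall w i, tcoord i (f w) = \sum_j F i j (tcoord j w)) /\
    forall a, intertwines F (M a).
Proof.
pose G i j v := tcoord i (f (tinj M j v)).
have GB i j : zmod_morphism (G i j).
  move=> u v; rewrite /G.
  have -> : tinj M j (u - v) = tinj M j u - tinj M j v.
    by apply/ffunP => l; rewrite !ffunE; case: ifP; rewrite ?subrr.
  by rewrite linearB /tcoord /= !ffunE.
pose F i j : {additive V -> W} :=
  HB.pack (G i j) (GRing.isZmodMorphism.Build V W (G i j) (GB i j)).
have FE w i : tcoord i (f w) = \sum_j F i j (tcoord j w).
  have {1}-> : w = \sum_j tinj M j (tcoord j w).
    apply/ffunP => i'; rewrite sum_ffunE (bigD1 i') //= ffunE eqxx.
    rewrite big1 ?addr0 // => j ji.
    by rewrite ffunE eq_sym (negbTE ji).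
  by rewrite linear_sum /tcoord /= sum_ffunE.
exists F; split=> // a i j v.
(* The relation compares two computations of one coordinate, by expanding [f] and by moving [a] out
   of [f]. *)
have <- : tcoord i (f (a *: tinj M j v)) = \sum_c F i c (M a c j *: v).
  rewrite FE; apply: eq_bigr => c _; congr (F i c _).
  rewrite /tcoord ffunE (bigD1 j) //= ffunE eqxx big1 ?addr0 // => l lj.
  by rewrite ffunE (negbTE lj) scaler0.
by rewrite linearZ /tcoord /= ffunE.
Qed.

(** * Reflecting isomorphisms and preserving indecomposability *)

Section Criterion.
Variables (k : fieldType) (A B : algType k) (M : free_bimod A B).
Variable o : 'I_(bimod_rank M).
Implicit Types V W : lmodType B.

(** As [tcoord o] is onto, [h] is determined by [f], and f |-> h respects composition and
    identities. *)
Hypothesis tcoord_morph : forall V W (f : {linear tensor M V -> tensor M W}),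
  exists h : {linear V -> W}, forall w, tcoord o (f w) = h (tcoord o w).

Hypothesis tcoord_nil : forall V (f : {linear tensor M V -> tensor M V}),
  (forall w, tcoord o (f w) = 0) -> forall w, f (f w) = 0.

Lemma tensor_reflects_iso V W : mod_iso (tensor M V) (tensor M W) -> mod_iso V W.
Proof.
case=> f [g fK gK]; have g_lin := can2_linear fK gK.
pose gL : {linear tensor M W -> tensor M V} := HB.pack g
  (GRing.isLinear.Build A (tensor M W) (tensor M V) _ g g_lin).
have [f' f'E] := tcoord_morph f; have [g' g'E] := tcoord_morph gL.
exists f'; exists g' => v; rewrite -[v](tinjK o).
  by rewrite -f'E -g'E /= fK.
by rewrite -g'E -f'E /= gK.
Qed.

Lemma idempotent_tcoord0 V (e : {linear tensor M V -> tensor M V}) :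
  (forall w, e (e w) = e w) -> (forall w, tcoord o (e w) = 0) -> forall w, e w = 0.
Proof. by move=> ee e0 w; rewrite -ee; exact: tcoord_nil. Qed.

(** A decomposition gives complementary idempotents [eU] and [eW]. The map induced by [eU] is
    idempotent on [V], hence 0 or 1, so [eU] or [eW] induces 0; being idempotent and of square zero,
    it vanishes. *)
Lemma tensor_indecomposable V : indecomposable V -> indecomposable (tensor M V).
Proof.
case=> V0 Vind; split=> [TV0|U W [f [g fK gK]]].
  by apply: V0 => v; rewrite -[v](tinjK o) (TV0 (tinj M o v)) /tcoord ffunE.
have g_lin := can2_linear fK gK.
pose gL : {linear (U * W)%type -> tensor M V} := HB.pack g
  (GRing.isLinear.Build A (U * W)%type (tensor M V) _ g g_lin).
pose eU w := gL ((f w).1, 0).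
pose eW w := gL (0, (f w).2).
have eU_lin : linear eU.
  move=> a u v; rewrite /eU -linearP [f _]linearP /=; congr (gL _); congr pair.
  by change (0 = a *: 0 + 0 :> W); rewrite scaler0 addr0.
have eW_lin : linear eW.
  move=> a u v; rewrite /eW -linearP [f _]linearP /=; congr (gL _); congr pair.
  by change (0 = a *: 0 + 0 :> U); rewrite scaler0 addr0.
pose eUL : {linear tensor M V -> tensor M V} := HB.pack eU
  (GRing.isLinear.Build A (tensor M V) (tensor M V) _ eU eU_lin).
pose eWL : {linear tensor M V -> tensor M V} := HB.pack eW
  (GRing.isLinear.Build A (tensor M V) (tensor M V) _ eW eW_lin).
have eUU w : eUL (eUL w) = eUL w by rewrite /= /eU /= gK.
have eWW w : eWL (eWL w) = eWL w by rewrite /= /eW /= gK.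
have eUW w : eUL w + eWL w = w.
  rewrite /= /eU /eW -linearD /= -[RHS]fK; congr g.
  by rewrite [RHS]surjective_pairing; congr pair; rewrite ?addr0 ?add0r.
have [h hE] := tcoord_morph eUL.
have hh v : h (h v) = h v by rewrite -[v](tinjK o) -!hE eUU.
have [U' [W' [iso h0 h1]]] := idempotent_split hh.
have coordD w w' : tcoord o (w + w') = tcoord o w + tcoord o w' by rewrite /tcoord ffunE.
case: (Vind U' W' iso) => [/h0 {}h0|/h1 {}h1]; [left=> u|right=> w].
  have e0 : forall w, eUL w = 0.
    by apply: (idempotent_tcoord0 eUU) => w; rewrite hE h0.
  have := e0 (g (u, 0)); rewrite /= /eU gK /= => /(congr1 f).
  by rewrite gK linear0 => -[].
have e0 : forall w, eWL w = 0.
  apply: (idempotent_tcoord0 eWW) => w'; apply: (addrI (tcoord o (eUL w'))).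
  by rewrite -coordD eUW hE h1 addr0.
have := e0 (g (0, w)); rewrite /= /eW gK /= => /(congr1 f).
by rewrite gK linear0 => -[].
Qed.

End Criterion.

(** * Auxiliary facts on three letters and on abelian groups *)

Lemma perm3_pair (l j : 'I_3) : l != j ->
  exists t : 'S_3, t o1 = l /\ t o2 = j.
Proof.
(* Composition is from left to right: the second factor carries the image of [o2] to [j] and fixes
   [l]. *)
move=> lj; exists (tperm o1 l * tperm (tperm o1 l o2) j)%g.
rewrite !permM !tpermL (@tpermD _ (tperm o1 l o2)) // 1?eq_sym //.
by rewrite -[X in X != _](tpermL o1 l) (inj_eq perm_inj).
Qed.

Lemma sum3 (U : zmodType) (G : 'I_3 -> U) : \sum_c G c = G o1 + G o2 + G o3.
Proof.
rewrite !big_ord_recl big_ord0 addr0 addrA.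
by congr (G _ + G _ + G _); apply: val_inj.
Qed.

Lemma addr_eq_cancel (U : zmodType) (a b c a' b' c' : U) :
  a + c = a' + c' -> a + b + c = a' + b' + c' -> b = b'.
Proof. by move=> e; rewrite addrAC e [RHS]addrAC => /addrI. Qed.

(** The first two equations give u' = - u, the second and fourth a = b + u, and then the first and
    third leave 3u = 0. In [link12_eqs], n, n', a are d (x v), q' (z v), d (y v); m, m', b are x (d
    v), z (q v), y (d v); and u, u' are q v, q' v. *)
Lemma link12_solve (U : zmodType) (n n' a m m' b u u' : U) :
    (forall w : U, w *+ 3 = 0 -> w = 0) ->
    n + n' = m + (m' + u) -> n + (n' + u') = m + m' ->
    n + (a + a) + n' = m + (b + b) + m' ->
    n + a + (n' + u') = m + b + (m' + u) ->
  [/\ u = 0, u' = 0, a = b & n + n' = m + m'].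
Proof.
move=> U3; rewrite !addrA => e1 e2 e3 e4.
have uu' : u' = - u.
  by apply/eqP; rewrite -addr_eq0 addrC -(inj_eq (addrI (m + m'))) addrA -e1 e2 addr0.
have ab : a = b + u.
  apply: (addrI (m + m')); rewrite -{1}e2 [LHS]addrAC [n + n' + a]addrAC e4.
  by rewrite [m + b + m']addrAC addrA.
have u0 : u = 0.
  apply: U3; move: e3; rewrite addrAC [n + a + n']addrAC e1 ab.
  rewrite [RHS]addrAC [m + b + m']addrAC -!addrA => /addrI /addrI e.
  apply: (addrI (b + b)); rewrite addr0 -[RHS]e !mulrS mulr0n addr0.
  by rewrite (AC (2*(1*2)) (3*(1*(4*(2*5))))).
by rewrite uu' u0 oppr0 ab e1 u0 !addr0.
Qed.

(** * Block matrices for the generators of [A0] *)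

Section LinkMatrices.
Variables (B : nzRingType) (x y : B).
Implicit Types t s : 'S_3.

Definition block_H t : 'M[B]_(3 + 3) :=
  block_mx (perm_mx t) 0 0 ((-1) ^+ t *: perm_mx t).

(* Column j, row l is the coefficient of a_t e_j on the l-th bottom vector.
   If i is the letter fixed by t, it is x + 2y for i = j = l, x + y + 1 for
   i <> j = l, x + y for i, j, l distinct, and x otherwise. *)
Definition link t : 'M[B]_3 :=
  \matrix_(l, j) (x + y *+ ((l == j) + (t l == j))
                  + ((l == j) && (t l != j))%:R).

Definition block_a t : 'M[B]_(3 + 3) := block_mx 0 0 (link t) 0.

Lemma block_H1 : block_H 1%g = 1%:M.
Proof. by rewrite /block_H odd_perm1 expr0 scale1r !perm_mx1 -scalar_mx_block. Qed.

Lemma block_HM t s : block_H (t * s)%g = block_H t *m block_H s.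
Proof.
rewrite /block_H mulmx_block !(mul0mx, mulmx0, addr0, add0r) perm_mxM.
congr block_mx; rewrite odd_permM signr_addb -scalerA.
by case: (odd_perm t); case: (odd_perm s);
  rewrite ?(expr0, expr1, scale1r, scaleN1r, mulNmx, mulmxN).
Qed.

Lemma block_aa t s : block_a t *m block_a s = 0.
Proof.
by rewrite /block_a mulmx_block !(mul0mx, mulmx0, addr0) block_mx0.
Qed.

(** An entry of [link] depends only on the equalities l = j and t l = j, which survive a relabelling
    of the letters. *)
Lemma link_conj t s :
  perm_mx t *m link s = link (t * s * t^-1)%g *m perm_mx t.
Proof.
rewrite -row_permE -[t in X in _ = _ *m X]invgK -col_permE; apply/matrixP => l j.
rewrite !mxE !permM.
by rewrite (can2_eq (permK t) (permKV t)) (inj_eq perm_inj).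
Qed.

Lemma block_Ha t s :
  block_H t *m block_a s = (-1) ^+ t *: (block_a (t * s * t^-1)%g *m block_H t).
Proof.
rewrite /block_H /block_a !mulmx_block !(mul0mx, mulmx0, addr0, add0r).
by rewrite scale_block_mx !scaler0 -scalemxAl link_conj.
Qed.

(** * Maps intertwining the block matrices *)

Section Intertwiners.
Variables (V W : lmodType B) (F : 'I_(3 + 3) -> 'I_(3 + 3) -> {additive V -> W}).

Let top := @lshift 3 3.
Let bot := @rshift 3 3.

Lemma sum_perm_col (G : 'I_3 -> {additive V -> W}) t j v :
  \sum_c G c (perm_mx t c (t j) *: v) = G j v.
Proof.
rewrite (bigD1 j) //= !mxE eqxx scale1r big1 ?addr0 // => c cj.
by rewrite !mxE (inj_eq perm_inj) (negbTE cj) scale0r raddf0.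
Qed.

Lemma sum_perm_row (G : 'I_3 -> W) t l :
  \sum_c perm_mx t l c *: G c = G (t l).
Proof.
rewrite (bigD1 (t l)) //= !mxE eqxx scale1r big1 ?addr0 // => c cj.
by rewrite !mxE eq_sym (negbTE cj) scale0r.
Qed.

Hypothesis FH : forall t, intertwines F (block_H t).

(** Commuting with the action of S_3 makes the block constant on orbits of pairs of letters. *)
Lemma top_perm t l j v : F (top (t l)) (top (t j)) v = F (top l) (top j) v.
Proof.
have := FH t (top l) (top (t j)) v; rewrite !big_split_ord /= /block_H.
under eq_bigr do rewrite block_mxEul.
under [X in _ + X]eq_bigr do rewrite block_mxEdl mxE scale0r raddf0.
under [in RHS]eq_bigr do rewrite block_mxEul.
under [X in _ = _ + X]eq_bigr do rewrite block_mxEur mxE scale0r.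
rewrite !big1_eq !addr0 sum_perm_row.
by rewrite (sum_perm_col (fun c => F (top l) (top c))) => ->.
Qed.

Lemma bot_perm t l j v : F (bot (t l)) (bot (t j)) v = F (bot l) (bot j) v.
Proof.
have := FH t (bot l) (bot (t j)) v; rewrite !big_split_ord /= /block_H.
under eq_bigr do rewrite block_mxEur mxE scale0r raddf0.
under [X in _ + X]eq_bigr do rewrite block_mxEdr mxE -scalerA.
under [in RHS]eq_bigr do rewrite block_mxEdl mxE scale0r.
under [X in _ = _ + X]eq_bigr do rewrite block_mxEdr mxE -scalerA.
rewrite !big1_eq !add0r -scaler_sumr sum_perm_row.
case: (odd_perm t); rewrite ?(expr0, expr1).
  under eq_bigr do rewrite scaleN1r raddfN.
  rewrite sumrN (sum_perm_col (fun c => F (bot l) (bot c))) scaleN1r.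
  by move/oppr_inj.
under eq_bigr do rewrite scale1r.
by rewrite (sum_perm_col (fun c => F (bot l) (bot c))) scale1r.
Qed.

(** The sign of [t] acts on the bottom only, so it does not cancel as in [bot_perm]. *)
Lemma top_bot_perm t l j v :
  F (top (t l)) (bot (t j)) v = (-1) ^+ t *: F (top l) (bot j) v.
Proof.
have := FH t (top l) (bot (t j)) v; rewrite !big_split_ord /= /block_H.
under eq_bigr do rewrite block_mxEur mxE scale0r raddf0.
under [X in _ + X]eq_bigr do rewrite block_mxEdr mxE -scalerA.
under [in RHS]eq_bigr do rewrite block_mxEul.
under [X in _ = _ + X]eq_bigr do rewrite block_mxEur mxE scale0r.
rewrite !big1_eq add0r addr0 sum_perm_row => <-.
case: (odd_perm t); rewrite ?(expr0, expr1).
  under eq_bigr do rewrite scaleN1r raddfN.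
  by rewrite sumrN (sum_perm_col (fun c => F (top l) (bot c))) scaleN1r.
under eq_bigr do rewrite scale1r.
by rewrite (sum_perm_col (fun c => F (top l) (bot c))) scale1r.
Qed.

(** The lower right block of F N = N F for N = [block_a s], whose right half is zero. *)
Lemma link_top_bot s l j v : intertwines F (block_a s) ->
  \sum_c link s l c *: F (top c) (bot j) v = 0.
Proof.
move=> /(_ (bot l) (bot j) v); rewrite !big_split_ord /= /block_a.
under eq_bigr do rewrite block_mxEur mxE scale0r raddf0.
under [X in _ + X]eq_bigr do rewrite block_mxEdr mxE scale0r raddf0.
under [in RHS]eq_bigr do rewrite block_mxEdl.
under [X in _ = _ + X]eq_bigr do rewrite block_mxEdr mxE scale0r.
by rewrite !big1_eq !addr0.
Qed.

Lemma link_bot_top s l j v : intertwines F (block_a s) ->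
  \sum_c F (bot l) (bot c) (link s c j *: v) =
  \sum_c link s l c *: F (top c) (top j) v.
Proof.
move=> /(_ (bot l) (top j) v); rewrite !big_split_ord /= /block_a.
under eq_bigr do rewrite block_mxEul mxE scale0r raddf0.
under [X in _ + X]eq_bigr do rewrite block_mxEdl.
under [in RHS]eq_bigr do rewrite block_mxEdl.
under [X in _ = _ + X]eq_bigr do rewrite block_mxEdr mxE scale0r.
by rewrite !big1_eq addr0 add0r.
Qed.

(** One transposition is enough: by [block_Ha] the matrices of the others are conjugate to this one
    up to sign. *)
Hypothesis F12 : intertwines F (block_a (tperm o1 o2)).

Lemma link12E l j : link (tperm o1 o2) l j =
  if l == j then if l == o3 then x + y *+ 2 else x + y + 1
  else if (l == o3) || (j == o3) then x else x + y.
Proof.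
by case: l j => [[|[|[|//]]] ?] [[|[|[|//]]] ?]; rewrite !mxE permE /= -?val_eqE /=
  ?mulr1n ?addr0 ?mulr0n ?addr0.
Qed.

(** S_3 has two orbits on pairs of letters, the diagonal and its complement. *)
Lemma top_diag (l j : 'I_3) v : F (top l) (top j) v =
  if l == j then F (top o1) (top o1) v else F (top o1) (top o2) v.
Proof.
case: eqP => [<-|/eqP lj]; first by rewrite -{1 2}(tpermL o1 l) top_perm.
by have [t [<- <-]] := perm3_pair lj; rewrite top_perm.
Qed.

Lemma bot_diag (l j : 'I_3) v : F (bot l) (bot j) v =
  if l == j then F (bot o1) (bot o1) v else F (bot o1) (bot o2) v.
Proof.
case: eqP => [<-|/eqP lj]; first by rewrite -{1 2}(tpermL o1 l) bot_perm.
by have [t [<- <-]] := perm3_pair lj; rewrite bot_perm.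
Qed.

Hypothesis W2 : forall w : W, w *+ 2 = 0 -> w = 0.
Hypothesis W3 : forall w : W, w *+ 3 = 0 -> w = 0.

(** The sign rule kills the diagonal, in the absence of 2-torsion, and leaves one unknown off the
    diagonal. *)
Lemma top_bot0 l j v : F (top l) (bot j) v = 0.
Proof.
have F33 : F (top o3) (bot o3) v = 0.
  apply: W2; have := top_bot_perm (tperm o1 o2) o3 o3 v.
  rewrite !tpermD // odd_tperm /= expr1 scaleN1r => e.
  by rewrite mulr2n {1}e addNr.
have F23 : F (top o2) (bot o3) v = - F (top o1) (bot o3) v.
  have := top_bot_perm (tperm o1 o2) o1 o3 v.
  by rewrite tpermL tpermD // odd_tperm /= expr1 scaleN1r.
(* The relation is (x + y + 1) F13 + (x + y) F23 + x F33 = 0, that is F13 = 0; the summand 1 in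
   [link] survives the cancellation. *)
have F13 : F (top o1) (bot o3) v = 0.
  have := link_top_bot o1 o3 v F12; rewrite sum3 !link12E /= F33 F23.
  by rewrite scaler0 addr0 scalerN -scalerBl [x + y + 1]addrC addrK scale1r.
have [<-|lj] := eqVneq l j.
  by have := top_bot_perm (tperm o3 l) o3 o3 v; rewrite tpermL F33 scaler0.
have [t [<- <-]] := perm3_pair lj.
have -> : t o2 = (tperm o2 o3 * t)%g o3 by rewrite permM tpermR.
have -> : t o1 = (tperm o2 o3 * t)%g o1 by rewrite permM tpermD.
by rewrite top_bot_perm F13 scaler0.
Qed.

Let z := x *+ 3 + y *+ 2.

Lemma link12_row l :
  \sum_c link (tperm o1 o2) l c = z + (l != o3)%:R.
Proof.
case: l => [[|[|[|//]]] ?]; rewrite sum3 !link12E /= -?val_eqE /= /z !mulrS !mulr0n !addr0.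
- by rewrite (AC (3*2*1) (1*4*6*(2*5)*3)) /= -!addrA.
- by rewrite (AC (2*3*1) (1*3*6*(2*4)*5)) /= -!addrA.
by rewrite !addrA (AC (1*1*1*1*1) (1*2*3*(4*5))).
Qed.

Lemma link12_col j :
  \sum_c link (tperm o1 o2) c j = z + (j != o3)%:R.
Proof.
rewrite -link12_row; apply: eq_bigr => c _; rewrite !link12E [c == j]eq_sym orbC.
by case: eqP => // <-.
Qed.

Let p := F (top o1) (top o1).
Let q := F (top o1) (top o2).
Let p' := F (bot o1) (bot o1).
Let q' := F (bot o1) (bot o2).
Let d v := p v - q v.
Let d' v := p' v - q' v.

(* Comparing the (l, j) entries of F_bot C = C F_top for C := link (tperm o1 o2),
   where F_top = d + q J and F_bot = d' + q' J for the all-ones matrix J. *)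
Lemma link12_key l j v :
  d' (link (tperm o1 o2) l j *: v) + q' ((z + (j != o3)%:R) *: v) =
  link (tperm o1 o2) l j *: d v + (z + (l != o3)%:R) *: q v.
Proof.
transitivity (\sum_c F (bot l) (bot c) (link (tperm o1 o2) c j *: v)).
  rewrite -link12_col scaler_suml raddf_sum (bigD1 l) //= [in RHS](bigD1 l) //=.
  rewrite bot_diag eqxx addrA subrK; congr (_ + _).
  by apply: eq_bigr => c cl; rewrite bot_diag eq_sym (negbTE cl).
rewrite link_bot_top // -link12_row scaler_suml (bigD1 j) //= [in RHS](bigD1 j) //=.
rewrite top_diag eqxx addrA scalerBr subrK; congr (_ + _).
by apply: eq_bigr => c cj; rewrite top_diag (negbTE cj).
Qed.

(** The entries (1, 1) and (2, 1) of C differ by 1, while the terms in q and q' of the two equations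
    agree; subtract. *)
Lemma d'E v : d' v = d v.
Proof.
have := link12_key o1 o1 v; have := link12_key o2 o1 v; rewrite !link12E /=.
rewrite [(x + y + 1) *: d v]scalerDl [(x + y + 1) *: v]scalerDl.
have d'D u w : d' (u + w) = d' u + d' w by rewrite /d' !raddfD /= addrACA.
rewrite d'D !scale1r => e21 e11; apply: addr_eq_cancel e21 e11.
Qed.

Lemma link12_eqs v :
  [/\ q v = 0, q' v = 0 & d (y *: v) = y *: d v].
Proof.
have dD u w : d (u + w) = d u + d w by rewrite /d !raddfD /= addrACA.
have e13 := link12_key o1 o3 v; have e31 := link12_key o3 o1 v.
have e33 := link12_key o3 o3 v; have e21 := link12_key o2 o1 v.
move: e13 e31 e33 e21; rewrite !link12E /= !d'E !addr0.
rewrite ![(z + 1) *: _]scalerDl ![(x + _) *: _]scalerDl !mulr2n.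
rewrite ![(y + y) *: _]scalerDl !dD !scale1r ![q' (_ + _)]raddfD.
by move=> e1 e2 e3 e4; have [] := link12_solve W3 e1 e2 e3 e4.
Qed.

(** The entry (1, 3) of C is x alone, and the terms in q and q' have been shown to vanish. *)
Lemma d_x v : d (x *: v) = x *: d v.
Proof.
have := link12_key o1 o3 v; rewrite !link12E /= d'E.
have [_ -> _] := link12_eqs ((z + 0) *: v).
by have [-> _ _] := link12_eqs v; rewrite scaler0 !addr0.
Qed.

Lemma intertwinerP :
  [/\ forall l j v, F (top l) (top j) v = if l == j then p v else 0,
      forall l j v, F (bot l) (bot j) v = if l == j then p v else 0,
      forall v, p (x *: v) = x *: p v & forall v, p (y *: v) = y *: p v].
Proof.
have q0 v : q v = 0 by have [] := link12_eqs v.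
have pd v : p v = d v by rewrite /d q0 subr0.
split=> [l j v|l j v|v|v].
- by rewrite top_diag -/(q v) q0.
- by rewrite bot_diag pd -d'E /d' -/(q' v); have [_ -> _] := link12_eqs v; rewrite subr0.
- by rewrite !pd d_x.
by rewrite !pd; have [_ _] := link12_eqs v.
Qed.

End Intertwiners.

End LinkMatrices.

(** * A representation of [A0] by matrices over [B] *)

Section BlockRelations.
Variables (k : fieldType) (A B : algType k) (x y : B).
Variables (F : {rmorphism A -> 'M[B]_(3 + 3)}) (H : 'S_3 -> A) (a : transp -> A).
Hypothesis Fc : forall c : k, F c%:A = (c%:A)%:M.
Hypothesis FH : forall t, F (H t) = block_H B t.
Hypothesis Fa : forall i, F (a i) = block_a x y (sval i).

Lemma block_rel_H1 : F (H 1%g - 1) = 0.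
Proof. by rewrite rmorphB rmorph1 FH block_H1 subrr. Qed.

Lemma block_rel_HM t s : F (H t * H s - H (t * s)%g) = 0.
Proof. by rewrite rmorphB rmorphM !FH block_HM subrr. Qed.

Lemma block_rel_Ha t i :
  F (H t * a i - (-1) ^+ t *: (a (transp_conj t i) * H t)) = 0.
Proof.
rewrite rmorphB -mulr_algl !rmorphM Fc FH !Fa /= -!mulmxE block_Ha.
have -> : ((-1) ^+ t)%:A = (-1) ^+ t :> B by exact: (rmorph_sign (in_alg B)).
by rewrite mul_scalar_mx subrr.
Qed.

Lemma block_rel_aa i j : F (a i * a j) = 0.
Proof. by rewrite rmorphM !Fa -mulmxE block_aa. Qed.

Lemma block_rel_aaa i j i' : F (a i * a j + a j * a i' + a i' * a i) = 0.
Proof. by rewrite 2!rmorphD /= !block_rel_aa !addr0. Qed.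

End BlockRelations.

(** The assignment on generators extends to the free algebra and kills the relations. Elements with
    the given images are only asserted to exist: a map commuting with all of [R] then commutes with
    these matrices. *)
Lemma A0_block_rep (k : fieldType) (B : algType k) (x y : B) :
  exists R : {rmorphism A0 k -> 'M[B]_(3 + 3)},
    [/\ forall c : k, R c%:A = (c%:A)%:M,
        forall t, exists a, R a = block_H B t &
        forall i : transp, exists a, R a = block_a x y (sval i)].
Proof.
pose f : {rmorphism k -> 'M[B]_(3 + 3)} := @scalar_mx B (3 + 3) \o in_alg B.
pose G (g : A0_gens) : 'M[B]_(3 + 3) :=
  match g with inl t => block_H B t | inr i => block_a x y (sval i) end.
have fG c g : GRing.comm (f c) (G g).
  apply/matrixP => i j; rewrite -!mulmxE /= mul_scalar_mx !mxE (bigD1 j) //=.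
  rewrite mxE eqxx mulr1n big1 ?addr0 => [|l lj]; last by rewrite mxE (negbTE lj) mulr0.
  by rewrite mulr_algl mulr_algr.
have [F [FG Fc]] := free_lift fG.
have [r|R RE] := @quot_lift _ _ _ (@A0_proper k) _ F.
  have FH t : F (genH k t) = block_H B t := FG (inl t).
  have Fa i : F (gena k i) = block_a x y (sval i) := FG (inr i).
  case=> [|t s|t i||]; first exact: block_rel_H1 FH.
  - exact: block_rel_HM FH t s.
  - exact: block_rel_Ha Fc FH Fa t i.
  - exact: block_rel_aa Fa t12 t12.
  exact: block_rel_aaa Fa t12 t23 t13.
exists R; split=> [c|t|i].
- by rewrite -[RHS]/(f c) -Fc -RE; congr (R _); rewrite to_quotZ.
- by exists (to_quot (@A0_proper k) (genH k t)); rewrite RE FG.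
by exists (to_quot (@A0_proper k) (gena k i)); rewrite RE FG.
Qed.

(** * Wildness of [A0] *)

(** The inverse of n in [k] acts on [W] through [B]. *)
Lemma lmod_torsion_free (k : fieldType) (B : algType k) (W : lmodType B) n :
  (n%:R != 0 :> k) -> forall w : W, w *+ n = 0 -> w = 0.
Proof.
move=> n0 w wn; have e : (n%:R^-1 : k)%:A * n%:R = 1 :> B.
  by rewrite mulr_algl -(scaler_nat n (1 : B)) scalerA mulVf // scale1r.
by rewrite -[w]scale1r -e -scalerA scaler_nat wn scaler0.
Qed.

Theorem proposition5p5 (k : closedFieldType) (char0 : [pchar k] =i pred0) :
  wild (A0 k).
Proof.
pose x := gen k true; pose y := gen k false.
have [R [Rc RH Ra]] := A0_block_rep x y.
pose M := FreeBimod Rc.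
pose top (l : 'I_3) : 'I_(bimod_rank M) := lshift 3 l.
pose bot (l : 'I_3) : 'I_(bimod_rank M) := rshift 3 l.
have n0 n : prime n -> n%:R != 0 :> k.
  by move=> pn; have := char0 n; rewrite !inE pn /= => ->.
(* Any such [f] is block lower triangular, with one B-linear map repeated along the whole
   diagonal. *)
have comps (V W : lmodType (freeAlg k bool)) (f : {linear tensor M V -> tensor M W}) :
  exists F : 'I_(3 + 3) -> 'I_(3 + 3) -> {additive V -> W},
    [/\ forall w i, tcoord i (f w) = \sum_(j < bimod_rank M) F i j (tcoord j w),
        forall l j v, F (top l) (top j) v = if l == j then F (top o1) (top o1) v else 0,
        forall l j v, F (bot l) (bot j) v = if l == j then F (top o1) (top o1) v else 0,
        forall l j v, F (top l) (bot j) v = 0 &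
        linear (F (top o1) (top o1))].
  have [F [FE FM]] := tensor_comps f.
  have FH t : intertwines F (block_H _ t) by have [a <-] := RH t; apply: FM.
  have F12 : intertwines F (block_a x y (tperm o1 o2)).
    by have [a <-] := Ra t12; apply: FM.
  have W2 := @lmod_torsion_free k _ W 2 (n0 2 isT).
  have W3 := @lmod_torsion_free k _ W 3 (n0 3 isT).
  have [Ft Fb Fx Fy] := intertwinerP FH F12 W3.
  exists F; split=> // [l j v|]; first exact: top_bot0 FH F12 W2 _ _ _.
  apply: free_linear => [c v|[] v] //.
  (* Scalars of [k] act by scalar matrices, so one diagonal entry gives compatibility with them. *)
  have := FM c%:A (top o1) (top o1) v; rewrite /= Rc.
  rewrite (bigD1 (top o1)) //= [in RHS](bigD1 (top o1)) //= !big1 => [|j j1|j j1].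
  - by rewrite !addr0 mxE eqxx mulr1n.
  - by rewrite mxE eq_sym (negbTE j1) scale0r.
  by rewrite mxE (negbTE j1) scale0r raddf0.
have morph (V W : lmodType (freeAlg k bool)) (f : {linear tensor M V -> tensor M W}) :
  exists h : {linear V -> W}, forall w, tcoord (top o1) (f w) = h (tcoord (top o1) w).
  have [F [FE Ft _ Ftb Fl]] := comps V W f.
  pose h : {linear V -> W} := HB.pack (F (top o1) (top o1) : V -> W)
    (GRing.isLinear.Build _ V W _ (F (top o1) (top o1)) Fl).
  exists h => w; rewrite FE big_split_ord /= [X in _ + X]big1 ?addr0 => [|j _];
    last exact: Ftb.
  rewrite (bigD1 o1) //= big1 ?addr0 // => j j1.
  by rewrite (Ft o1 j) eq_sym (negbTE j1).
(* Once the diagonal map is 0, [f] only sends top to bottom. *)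
have nil (V : lmodType (freeAlg k bool)) (f : {linear tensor M V -> tensor M V}) :
  (forall w, tcoord (top o1) (f w) = 0) -> forall w, f (f w) = 0.
  move=> f0; have [F [FE Ft Fb Ftb _]] := comps V V f.
  have h0 v : F (top o1) (top o1) v = 0.
    rewrite -(f0 (tinj M (top o1) v)) FE (bigD1 (top o1)) //= tinjK.
    rewrite big1 ?addr0 // => j j1; rewrite /tcoord ffunE (negbTE j1); exact: raddf0.
  have ftop w l : tcoord (top l) (f w) = 0.
    rewrite FE big_split_ord /= !big1 ?addr0 // => j _.
    by rewrite (Ft l j) h0 if_same.
  move=> w; apply/ffunP => i; rewrite -[LHS]/(tcoord i (f (f w))) ffunE.
  case: (split_ordP i) => l ->; first exact: ftop.
  (* A bottom coordinate of f (f w) receives the top of f w, which is 0, and its bottom only through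
     the zero diagonal map. *)
  rewrite FE big_split_ord /= !big1 ?addr0 // => j _.
    by rewrite (Fb l j) h0 if_same.
  by rewrite (ftop w j); apply: raddf0.
exists M; split=> [V _|V W _ _].
  exact: (tensor_indecomposable morph nil).
exact: (tensor_reflects_iso morph).
Qed.
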